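(* Let $G$ be a graph on the set of vertices $\{1,\ldots,n\}$, and let $\overline{G}$ be its complement. Then, as polynomials in $x,x_1,\ldots,x_n$, $$f_G(x;x_1,\ldots,x_n)=(-1)^{n-1}\cdot f_{\overline{G}}(-x-x_1-\cdots-x_n;\,x_1,\ldots,x_n).$$
   Context: Graphs are finite and simple, $n\ge 1$. The complement $\overline{G}$ of a graph $G$ on $\{1,\ldots,n\}$ has the same vertex set, and an edge belongs to $\overline{G}$ iff it does not belong to $G$. The extended graph $\widetilde{G}$ is the graph on $\{0,1,\ldots,n\}$ obtained from $G$ by adding the edge $\{0,v\}$ for every $v\in\{1,\ldots,n\}$. Assign the variable $x$ to the vertex $0$ (write $x_0=x$) and the variable $x_i$ to the vertex $i$ for $1\le i\le n$. For a spanning tree $T$ of $\widetilde{G}$ put $m(T)=\prod_{v=0}^{n}x_v^{\rho_T(v)-1}$, where $\rho_T(v)$ is the degree of $v$ in $T$. The graph polynomial is $$f_G(x;x_1,\ldots,x_n)=\sum_{T}m(T),$$ where the sum runs over all spanning trees $T$ of $\widetilde{G}$; $f_{\overline{G}}$ is defined in the same way from $\overline{G}$. *)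

(* Defs.v *)
From HB Require Import structures.
From mathcomp Require Import all_boot all_order all_algebra.
From mathcomp Require Import mpoly.

Set Implicit Arguments.
Unset Strict Implicit.
Unset Printing Implicit Defensive.

Import GRing.Theory.
Local Open Scope ring_scope.

Record sgraph (V : finType) := SGraph {
  adj :> rel V;
  adj_sym : ssrbool.symmetric adj;
  adj_irr : irreflexive adj
}.

Section Graphs.
Variable V : finType.

Section Complement.
Variable G : sgraph V.

Definition compl_adj : rel V := fun u v => (u != v) && ~~ G u v.

Lemma compl_adj_sym : ssrbool.symmetric compl_adj.
Proof. by move=> u v; rewrite /compl_adj eq_sym adj_sym. Qed.

Lemma compl_adj_irr : irreflexive compl_adj.
Proof. by move=> u; rewrite /compl_adj eqxx. Qed.

Definition compl_graph : sgraph V := SGraph compl_adj_sym compl_adj_irr.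

Definition edges : {set {set V}} :=
  [set [set p.1; p.2] | p : V * V & G p.1 p.2].

End Complement.

(* A spanning subgraph is encoded by its edge set F, a set of 2-subsets of V. *)
Definition edge_rel (F : {set {set V}}) : rel V :=
  fun u v => [set u; v] \in F.

Definition connected_edges (F : {set {set V}}) : bool :=
  [forall u, forall v, connect (edge_rel F) u v].

(* Cycles have pairwise distinct vertices and length at least 3; the length is
   bounded by #|V| only to make the quantification finite. *)
Definition acyclic_edges (F : {set {set V}}) : bool :=
  [forall k : 'I_#|V|.+1, forall c : k.-tuple V,
    ~~ [&& (2 < k)%N, uniq c & cycle (edge_rel F) c]].

Definition spanning_tree (G : sgraph V) (F : {set {set V}}) : bool :=
  [&& F \subset edges G, connected_edges F & acyclic_edges F].

Definition degree (F : {set {set V}}) (v : V) : nat :=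
  #|[set e in F | v \in e]|.

End Graphs.

(* The vertices 1, ..., n of G are the elements of 'I_n; the vertices of the
   extended graph are those of 'I_n.+1, where ord0 is the new vertex 0 and
   i : 'I_n becomes lift ord0 i. *)
Section Extended.
Variables (n : nat) (G : sgraph 'I_n).

Definition ext_adj : rel 'I_n.+1 := fun u v =>
  match unlift ord0 u, unlift ord0 v with
  | Some i, Some j => G i j
  | None, None => false
  | _, _ => true
  end.

Lemma ext_adj_sym : ssrbool.symmetric ext_adj.
Proof.
move=> u v; rewrite /ext_adj.
by case: (unlift ord0 u) (unlift ord0 v) => [i|] [j|] //; rewrite adj_sym.
Qed.

Lemma ext_adj_irr : irreflexive ext_adj.
Proof.
by move=> u; rewrite /ext_adj; case: (unlift ord0 u) => // i; rewrite adj_irr.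
Qed.

Definition ext_graph : sgraph 'I_n.+1 := SGraph ext_adj_sym ext_adj_irr.

End Extended.

(* When n > 0 every degree in a spanning tree is positive, so that the
   truncated predecessor is the usual one. *)
Definition tree_monomial (n : nat) (F : {set {set 'I_n.+1}}) :
    {mpoly int[n.+1]} :=
  \prod_(v < n.+1) 'X_v ^+ (degree F v).-1.

(* 'X_ord0 is x and 'X_(lift ord0 i) is the variable of the vertex i. *)
Definition graph_poly (n : nat) (G : sgraph 'I_n) : {mpoly int[n.+1]} :=
  \sum_(F : {set {set 'I_n.+1}} | spanning_tree (ext_graph G) F)
    tree_monomial F.

(* The polynomial f(q; x_1, ..., x_n). *)
Definition subst_x (n : nat) (f q : {mpoly int[n.+1]}) : {mpoly int[n.+1]} :=
  f \mPo [tuple if i == ord0 then q else 'X_i | i < n.+1].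

(* Main.v *)
Require Import Defs.
From HB Require Import structures.
From mathcomp Require Import all_boot all_order all_algebra.
From mathcomp Require Import mpoly zify.

Set Implicit Arguments.
Unset Strict Implicit.
Unset Printing Implicit Defensive.

Import GRing.Theory.
Local Open Scope ring_scope.

(** The identity is proved for the trees on an arbitrary vertex set A containing
    the root vertex 0, by induction on A; taking for A the whole vertex set gives
    the theorem. Write f_(G,A) for the sum of the monomials of the trees on A.

    Setting x_i = 0 for a vertex i <> 0 of A kills every tree except those in which
    i is a leaf. Such a tree is a tree on A minus i together with an edge from i
    to some neighbour j, and this edge multiplies the monomial by x_j. Hence, as soon
    as A minus i still has two vertices ([tree_sum_leaf]),
      f_(G,A) at x_i = 0  is  (sum of the x_j, j adjacent to i) * f_(G,A minus i).
    Under x -> -x - (sum of the x_v), with x_i = 0, the factor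
      x + (sum over the neighbours of i in the complement)
    becomes minus the factor
      x + (sum over the neighbours of i in G),
    because the vertices other than 0 and i are exactly divided between G and
    its complement. So both sides of the identity obey the same
    recursion, the sign included, and their difference p vanishes at x_i = 0 for
    each of the |A| - 1 vertices i <> 0, by induction.

    A tree on A has |A| - 1 edges, so p is homogeneous of degree |A| - 2
    ([tree_sum_homog]); substituting a linear form for x does not change this.
    A monomial of that degree cannot involve all |A| - 1 variables x_i, i <> 0,
    so each of its coefficients survives in some specialisation x_i = 0, and
    p = 0 ([homog_zero_var_eq0]). *)

(** * Trees on a vertex subset, and their leaves *)

Section TreeCombinatorics.
Variables (V : finType) (G : sgraph V).
Implicit Types (A : {set V}) (F : {set {set V}}) (i j u v w : V).

Lemma set2_eq u v i j :
  ([set u; v] == [set i; j]) =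
  ((u == i) && (v == j)) || ((u == j) && (v == i)).
Proof.
apply/eqP/idP => [E|]; last first.
  by case/orP=> /andP[/eqP-> /eqP->] //; rewrite setUC.
have: u \in [set i; j] by rewrite -E set21.
have: v \in [set i; j] by rewrite -E set22.
have: i \in [set u; v] by rewrite E set21.
have: j \in [set u; v] by rewrite E set22.
rewrite !inE ![i == _]eq_sym ![j == _]eq_sym.
by move: (u == i) (v == j) (u == j) (v == i) => [] [] [] [].
Qed.

Lemma mem_edges u v : ([set u; v] \in edges G) = G u v.
Proof.
apply/idP/idP => [/imsetP[[a b]]|Guv]; last first.
  by apply/imsetP; exists (u, v); rewrite // inE.
rewrite inE /= => Gab /eqP; rewrite set2_eq.
by case/orP=> /andP[/eqP-> /eqP->] //; rewrite adj_sym.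
Qed.

Lemma edgesP F e :
  F \subset edges G -> e \in F -> exists u v, e = [set u; v] /\ G u v.
Proof.
by move=> /subsetP sF /sF /imsetP[[u v]]; rewrite inE /= => Guv ->; exists u, v.
Qed.

Lemma edge_rel_sym F : ssrbool.symmetric (edge_rel F).
Proof. by move=> u v; rewrite /edge_rel setUC. Qed.

Lemma edge_rel_connect_sym F : connect_sym (edge_rel F).
Proof. exact/sym_connect_sym/edge_rel_sym. Qed.

Lemma edge_rel_setU1 F i j u v :
  edge_rel ([set i; j] |: F) u v =
  [|| (u == i) && (v == j), (u == j) && (v == i) | edge_rel F u v].
Proof. by rewrite /edge_rel in_setU1 set2_eq orbA. Qed.

(** Applied to a map [f] that retracts a vertex onto a neighbour, this pushes
    paths off that vertex. *)
Lemma connect_homo (T U : finType) (e : rel T) (e' : rel U) (f : T -> U) :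
  (forall x y, e x y -> connect e' (f x) (f y)) ->
  forall x y, connect e x y -> connect e' (f x) (f y).
Proof.
move=> ef x y /connectP[p ep ->]; elim: p x ep => [|z p IHp] x /=.
  by rewrite connect0.
by case/andP=> /ef xz /IHp; apply: connect_trans.
Qed.

(** A cycle without repetition has at most #|V| vertices, so the length bound
    may be dropped. *)
Lemma acyclicP F :
  reflect (forall c, (2 < size c)%N -> uniq c -> ~ cycle (edge_rel F) c)
          (acyclic_edges F).
Proof.
apply: (iffP idP) => [/forallP acF c c3 uc cc|acF]; last first.
  apply/forallP=> k; apply/forallP=> c; apply/and3P=> -[k3 uc].
  by apply: acF; rewrite ?size_tuple.
have ck : (size c < #|V|.+1)%N by rewrite ltnS -(card_uniqP uc) max_card.
have /forallP/(_ (in_tuple c)) := acF (Ordinal ck).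
by rewrite /= c3 uc cc.
Qed.

(** Trees on a subset [A] are edge sets over the ambient vertex type, so that
    deleting a vertex changes neither the type of the vertices nor the
    polynomial ring. *)
Definition tree_on A F : bool :=
  [&& F \subset edges G, [forall e in F, e \subset A],
      [forall u in A, forall v in A, connect (edge_rel F) u v]
    & acyclic_edges F].

Lemma tree_on_setT F : tree_on setT F = spanning_tree G F.
Proof.
rewrite /tree_on /spanning_tree /connected_edges.
have -> : [forall e in F, e \subset setT] by apply/forall_inP=> e _; apply: subsetT.
rewrite andTb; congr (_ && (_ && _)); apply: eq_forallb => u; rewrite inE /=.
by apply: eq_forallb => v; rewrite inE.
Qed.

Lemma tree_edge A F u v :
  tree_on A F -> edge_rel F u v -> [/\ G u v, u != v, u \in A & v \in A].
Proof.
case/and4P=> /subsetP sFG /forall_inP sFA _ _ Fuv.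
have := sFA _ Fuv; rewrite subUset !sub1set => /andP[uA vA].
have Guv : G u v by rewrite -mem_edges sFG.
by split=> //; apply/eqP=> uv; rewrite uv adj_irr in Guv.
Qed.

Lemma tree_connect A F u v :
  tree_on A F -> u \in A -> v \in A -> connect (edge_rel F) u v.
Proof. by case/and4P=> _ _ /forall_inP h _ /h /forall_inP; apply. Qed.

Lemma tree_neighbour A F v :
  tree_on A F -> v \in A -> (1 < #|A|)%N -> exists w, edge_rel F v w.
Proof.
move=> tF vA; rewrite (cardsD1 v) vA ltnS card_gt0 => /set0Pn[u].
rewrite !inE => /andP[uv uA].
have /connectP[[|w p] /=] := tree_connect tF vA uA.
  by move=> _ E; rewrite E eqxx in uv.
by case/andP=> vw _ _; exists w.
Qed.

Lemma incident_edge A F v e :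
  tree_on A F -> e \in F -> v \in e -> exists2 w, e = [set v; w] & edge_rel F v w.
Proof.
case/andP=> sFG _ eF; have [a [b [Ee _]]] := edgesP sFG eF.
move: eF; rewrite Ee => eF; rewrite !inE => /orP[]/eqP->; first by exists b.
by exists a; rewrite 1?edge_rel_sym // setUC.
Qed.

Lemma degree_gt0 A F v :
  tree_on A F -> v \in A -> (1 < #|A|)%N -> (0 < degree F v)%N.
Proof.
move=> tF vA /(tree_neighbour tF vA)[w vw].
by apply/card_gt0P; exists [set v; w]; rewrite !inE eqxx andbT.
Qed.

Lemma degree_out F v : {in F, forall e : {set V}, v \notin e} -> degree F v = 0%N.
Proof.
move=> vF; apply/eqP; rewrite cards_eq0; apply/eqP/setP=> e; rewrite !inE.
by apply/andP=> -[/vF/negP].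
Qed.

Lemma degree_setU1 F e v :
  e \notin F -> degree (e |: F) v = ((v \in e) + degree F v)%N.
Proof.
move=> eF; rewrite /degree; case ve: (v \in e); last first.
  apply: eq_card => e'; rewrite !inE; case: eqP => //= ->.
  by rewrite ve andbF.
rewrite (_ : [set _ in _ | _] = e |: [set e' in F | v \in e']).
  by rewrite cardsU1 !inE (negbTE eF).
by apply/setP=> e'; rewrite !inE; case: eqP => [->|].
Qed.

(** Adding or removing a pendant edge preserves trees: a cycle through [i] would
    use two different neighbours of [i], and retracting [i] onto [j] turns
    every path into one that avoids [i]. *)
Lemma tree_attach_leaf A F i j :
  i \in A -> {in F, forall e : {set V}, i \notin e} ->
  tree_on A ([set i; j] |: F) = [&& j \in A, G i j & tree_on (A :\ i) F].
Proof.
move=> iA iF.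
have Fi u v : edge_rel F u v -> (u != i) && (v != i).
  by move/iF; rewrite !inE negb_or ![i == _]eq_sym.
apply/idP/and3P => [tF|[jA Gij tF]].
  have [|Gij nij _ jA] := tree_edge (u := i) (v := j) tF.
    by rewrite edge_rel_setU1 !eqxx.
  split=> //; case/and4P: tF => sFG /forall_inP sFA /forall_inP cF /acyclicP aF.
  apply/and4P; split.
  - exact: subset_trans (subsetUr _ _) sFG.
  - apply/forall_inP=> e eF; rewrite subsetD1 iF // andbT.
    by apply: sFA; rewrite inE eF orbT.
  (* Paths between the remaining vertices are retracted along i |-> j. *)
  - pose f u := if u == i then j else u.
    apply/forall_inP=> u /setD1P[ui uA]; apply/forall_inP=> v /setD1P[vi vA].
    have /forall_inP/(_ v vA) := cF u uA.
    move/(connect_homo (e' := edge_rel F) (f := f)).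
    rewrite /f (negbTE ui) (negbTE vi); apply=> x y.
    rewrite edge_rel_setU1 => /or3P[/andP[/eqP-> /eqP->]|/andP[/eqP-> /eqP->]|xy].
    + by rewrite eqxx if_same connect0.
    + by rewrite eqxx if_same connect0.
    + by have /andP[/negbTE-> /negbTE->] := Fi _ _ xy; apply: connect1.
  - apply/acyclicP=> c c3 uc cc; apply: (aF c) => //.
    by apply: sub_cycle cc => x y xy; rewrite edge_rel_setU1 xy !orbT.
have nij : i != j by apply/eqP=> ij; rewrite ij adj_irr in Gij.
have edge_i u : edge_rel ([set i; j] |: F) i u -> u = j.
  rewrite edge_rel_setU1 (negbTE nij) /= eqxx /= => /orP[/eqP//|/Fi].
  by rewrite eqxx.
have cF := tree_connect tF; case/and4P: tF => sFG /forall_inP sFA _ /acyclicP aF.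
apply/and4P; split.
- by rewrite subUset sub1set mem_edges Gij.
- apply/forall_inP=> e; rewrite !inE => /orP[/eqP->|/sFA/subset_trans]; last first.
    by apply; exact: subsetDl.
  by rewrite subUset !sub1set iA.
- have toj u : u \in A -> connect (edge_rel ([set i; j] |: F)) u j.
    move=> uA; have [->|ui] := eqVneq u i.
      by apply: connect1; rewrite edge_rel_setU1 !eqxx.
    apply: (connect_sub (e := edge_rel F)) => [x y xy|].
      by apply: connect1; rewrite edge_rel_setU1 xy !orbT.
    by apply: cF; rewrite !inE ?ui // eq_sym nij.
  apply/forall_inP=> u uA; apply/forall_inP=> v vA.
  by apply: connect_trans (toj u uA) _; rewrite edge_rel_connect_sym toj.
- apply/acyclicP=> c c3 uc cc.
  have [ic|ic] := boolP (i \in c); last first.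
    apply: (aF c) => //; apply: (sub_in_cycle (P := fun x => x != i)) cc.
      move=> x y xi yi; rewrite edge_rel_setU1.
      by rewrite /in_mem /= in xi yi; rewrite (negbTE xi) (negbTE yi) !andbF.
    by apply/allP=> x xc; rewrite /in_mem /=; apply: contraNneq ic => <-.
  (* Read the cycle from i: its second and its last vertex are neighbours of i,
     hence both are j, against the absence of repetition. *)
  have [k c' rc] := rot_to ic.
  rewrite -(rot_cycle k) rc in cc; rewrite -(rot_uniq k) rc in uc.
  rewrite -(size_rot k) rc in c3.
  case: c' c3 uc cc {rc} => [|a c'] //= c3 /and3P[_ ac' _].
  case/andP=> /edge_i aj; rewrite rcons_path => /andP[_].
  rewrite edge_rel_sym => /edge_i lj.
  case: c' c3 ac' lj => //= b c' _ ac' lj.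
  by rewrite aj -lj mem_last in ac'.
Qed.

(** Otherwise a simple path starting at the root could be prolonged forever: its
    end has a second neighbour, which by acyclicity lies off the path. *)
Lemma tree_has_leaf A F r :
  tree_on A F -> r \in A -> (1 < #|A|)%N ->
  exists i, [/\ i \in A, i != r & degree F i = 1%N].
Proof.
move=> tF rA A2.
suff: [exists i in A, (i != r) && (degree F i == 1%N)].
  by case/exists_inP=> i iA /andP[ir /eqP di]; exists i.
apply: contraT => /exists_inPn noleaf.
(* Paths are listed backwards, from their free end v to the root r. *)
have long k : exists v u q, [/\ size q = k, path (edge_rel F) v (u :: q),
     uniq [:: v, u & q] & last u q = r].
  elim: k => [|k [v [u [q [sq pq uq lq]]]]].
    have [v rv] := tree_neighbour tF rA A2.
    have [_ nrv _ _] := tree_edge tF rv.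
    by exists v, r, [::]; rewrite /= inE eq_sym nrv edge_rel_sym rv.
  have vu : edge_rel F v u by case/andP: pq.
  have [_ _ vA _] := tree_edge tF vu.
  have vr : v != r.
    by rewrite -lq; apply: contraTneq uq => /= ->; rewrite mem_last.
  have := noleaf v vA; rewrite vr /= /degree => dv1.
  have vuS : [set v; u] \in [set e in F | v \in e] by rewrite !inE eqxx andbT.
  have : (0 < #|[set e in F | v \in e] :\ [set v; u]|)%N.
    rewrite lt0n; apply: contraNneq dv1 => d0.
    by rewrite (cardsD1 [set v; u]) vuS d0.
  case/card_gt0P=> e; rewrite !inE => /and3P[evu eF ve].
  have [w Ee vw] := incident_edge tF eF ve.
  have wu : w != u by apply: contraNneq evu => <-; rewrite Ee.
  have [_ nvw _ _] := tree_edge tF vw.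
  exists w, v, (u :: q); split=> //; first by rewrite /= sq.
    by apply/andP; split; first by rewrite edge_rel_sym.
  apply/andP; split; last exact: uq.
  rewrite in_cons eq_sym (negbTE nvw) in_cons (negbTE wu) /=; apply/negP=> wq.
  case/splitPr: q / wq sq pq uq lq => q1 q2 _ pq uq _.
  case/and4P: tF => _ _ _ /acyclicP/(_ [:: v, u & rcons q1 w]); apply.
  - by rewrite /= size_rcons.
  - by move: uq; rewrite -cat_rcons -!cat_cons cat_uniq => /andP[].
  - move: pq; rewrite -cat_rcons -cat_cons cat_path => /andP[pq _].
    by rewrite (cycle_path v) /= last_rcons edge_rel_sym vw.
have [v [u [q [sq _ uq _]]]] := long #|V|.
have := max_card (mem [:: v, u & q]).
by rewrite (card_uniqP uq) /= sq ltnNge leqnSn.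
Qed.

(** For a leaf [i], this removes the pendant edge at [i]. *)
Definition detach i F := [set e in F | i \notin e].

Lemma leaf_decomp A F i :
  tree_on A F -> degree F i = 1%N ->
  exists j, [/\ j \in A, edge_rel F i j & F = [set i; j] |: detach i F].
Proof.
move=> tF /eqP/cards1P[e Ee].
have : e \in [set e in F | i \in e] by rewrite Ee set11.
rewrite inE => /andP[eF ie].
have [j Ej ij] := incident_edge tF eF ie.
have [_ _ _ jA] := tree_edge tF ij.
exists j; split=> //; apply/setP=> e'; rewrite !inE -Ej.
have [ie'|_] := boolP (i \in e'); last first.
  by rewrite andbT; case: eqP => // ->; rewrite eF.
rewrite andbF orbF; have /setP/(_ e') := Ee.
by rewrite !inE ie' andbT.
Qed.

Lemma detach_notin i F : {in detach i F, forall e : {set V}, i \notin e}.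
Proof. by move=> e; rewrite inE => /andP[]. Qed.

Lemma tree_notin A F i :
  tree_on (A :\ i) F -> {in F, forall e : {set V}, i \notin e}.
Proof.
case/and4P=> _ /forall_inP sFA _ _ e /sFA; rewrite subsetD1.
by case/andP.
Qed.

Lemma pendant_notin F i j :
  {in F, forall e : {set V}, i \notin e} -> [set i; j] \notin F.
Proof. by move=> iF; apply/negP=> /iF; rewrite !inE eqxx. Qed.

(** A tree on [A] has |A| - 1 edges, counted through their endpoints; stripping
    leaves reduces this to a single vertex. *)
Lemma tree_sum_degree A F r :
  tree_on A F -> r \in A -> (\sum_v degree F v = (#|A|.-1).*2)%N.
Proof.
elim: {A}#|A| {-2}A (erefl #|A|) F => [|k IHk] A cA F tF rA.
  by move/eqP: cA; rewrite cards_eq0 => /eqP A0; rewrite A0 inE in rA.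
have [k0|k0] := posnP k.
  rewrite cA k0 /= big1 // => v _; apply: degree_out => e eF; apply/negP=> ve.
  have [w _ vw] := incident_edge tF eF ve.
  have [_ nvw vA wA] := tree_edge tF vw.
  have/cards1P[z Az] : #|A| == 1%N by rewrite cA k0.
  move: nvw vA wA; rewrite Az !inE => /eqP nvw /eqP vz /eqP wz.
  by case: nvw; rewrite vz wz.
have [|i [iA ir di]] := tree_has_leaf tF rA; first by rewrite cA.
have [j [jA ij EF]] := leaf_decomp tF di.
have iF := @detach_notin i F; have nF := pendant_notin j iF.
have [_ nij _ _] := tree_edge tF ij.
have cAi : #|A :\ i| = k by move: cA; rewrite (cardsD1 i) iA => -[].
move: tF; rewrite EF tree_attach_leaf // => /and3P[_ _ tF].
under eq_bigr do rewrite degree_setU1 //.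
rewrite cA big_split /= (IHk _ cAi) ?inE ?rA 1?eq_sym ?ir // cAi.
by rewrite -big_mkcond /= sum1_card cards2 nij -{2}(prednK k0) doubleS.
Qed.

End TreeCombinatorics.

(** * The tree polynomial and its specialisation at a vertex *)

Section TreeSum.
Variables (V : finType) (R : comNzRingType).
Implicit Types (G : sgraph V) (A : {set V}) (F : {set {set V}}) (y : V -> R).

(** The degree of the monomial of a tree. Two vertices are needed for every
    degree to be positive, hence for the predecessors not to be truncated. *)
Lemma tree_sum_pred_degree G A F :
  tree_on G A F -> (1 < #|A|)%N -> (\sum_v (degree F v).-1 = #|A| - 2)%N.
Proof.
move=> tF A2.
have /card_gt0P[r rA] : (0 < #|A|)%N by apply: leq_trans A2.
have := tree_sum_degree tF rA.
have -> : (\sum_v degree F v = \sum_v (degree F v).-1 + #|A|)%N.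
  rewrite -sum1_card [X in (_ + X)%N]big_mkcond -big_split /=.
  apply: eq_bigr => v _; case: ifPn => vA.
    by rewrite addn1 prednK // (degree_gt0 tF vA).
  rewrite (@degree_out _ F v) // => e eF; apply: contra vA => ve.
  have [w _ vw] := incident_edge tF eF ve.
  by case: (tree_edge tF vw).
by rewrite -addnn; lia.
Qed.

(** The graph polynomial evaluated at arbitrary values [y]; vertices outside [A]
    have degree 0 and contribute 1. *)
Definition tree_sum G A y : R :=
  \sum_(F | tree_on G A F) \prod_v y v ^+ (degree F v).-1.

Lemma eq_tree_sum G A y z :
  {in A, y =1 z} -> tree_sum G A y = tree_sum G A z.
Proof.
move=> yz; apply: eq_bigr => F tF; apply: eq_bigr => v _.
have [/yz-> //|vA] := boolP (v \in A).
rewrite (@degree_out _ F v) // => e eF; apply: contra vA => ve.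
have [w _ vw] := incident_edge tF eF ve.
by case: (tree_edge tF vw).
Qed.

(** With y_i = 0 only the trees in which [i] is a leaf survive, and those are the
    pairs of a neighbour j of [i] and a tree on the remaining vertices, whose
    degree at j grows by one. The bound on |A| makes the degree at j positive
    before the edge is attached, so that its monomial does gain a factor y_j. *)
Lemma tree_sum_leaf G A y i :
  i \in A -> (2 < #|A|)%N -> y i = 0 ->
  tree_sum G A y =
  (\sum_(j in A :\ i | G i j) y j) * tree_sum G (A :\ i) y.
Proof.
move=> iA A3 yi0; have A2 := ltnW A3.
have Ai2 : (1 < #|A :\ i|)%N by move: A3; rewrite (cardsD1 i) iA.
rewrite [LHS](bigID (fun F => degree F i == 1%N)) /= [X in _ + X]big1 ?addr0.
  (* join and split are the two directions of the correspondence between trees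
     with leaf i and pairs (neighbour of i, remaining tree). *)
  rewrite big_distrlr /= pair_big /=.
  pose join (p : V * {set {set V}}) := [set i; p.1] |: p.2.
  pose nbr F := odflt i [pick j | edge_rel F i j].
  pose split F := (nbr F, detach i F).
  have splitK (p : V * {set {set V}}) :
    {in p.2, forall e : {set V}, i \notin e} -> split (join p) = p.
    case: p => j F /= iF; rewrite /split /join /nbr; congr (_, _).
      case: pickP => [k|/(_ j)] /=; rewrite edge_rel_setU1 ?eqxx //.
      have ik : edge_rel F i k = false.
        by apply/negP=> /iF; rewrite !inE eqxx.
      rewrite ik orbF => /orP[/eqP//|/andP[/eqP ij /eqP ki]].
      by rewrite ki.
    apply/setP=> e; rewrite !inE.
    by case: eqP => [->|_] /=; [rewrite set21 (negbTE (pendant_notin j iF))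
      | apply: andb_idr => /iF].
  rewrite (reindex_onto join split) => [|F /andP[tF /eqP di]] /=; last first.
    have [j [jA ij EF]] := leaf_decomp tF di.
    rewrite EF; rewrite -[_ |: _]/(join (j, detach i F)) splitK //=.
    exact: detach_notin.
  apply: eq_big => [[j F]|[j F]] /=.
    apply/andP/andP=> [[/andP[tF di] /eqP sp]|[/andP[jA Gij] tF]].
      have iF : {in F, forall e : {set V}, i \notin e}.
        by case: sp => _ <-; apply: detach_notin.
      move: tF; rewrite tree_attach_leaf // => /and3P[jA Gij tF].
      split=> //; rewrite !inE jA Gij !andbT.
      by apply: contraTneq Gij => ->; rewrite adj_irr.
    have iF := tree_notin tF; rewrite splitK // eqxx.
    rewrite tree_attach_leaf // Gij tF (subsetP (subsetDl A [set i])) //=.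
    rewrite degree_setU1 ?pendant_notin // !inE eqxx /=.
    by rewrite (degree_out iF).
  case/andP=> /andP[tF _] /eqP sp.
  have iF : {in F, forall e : {set V}, i \notin e}.
    by case: sp => _ <-; apply: detach_notin.
  move: tF; rewrite tree_attach_leaf // => /and3P[jA Gij tF].
  have ji : j != i by apply: contraTneq Gij => ->; rewrite adj_irr.
  have jAi : j \in A :\ i by rewrite !inE ji.
  rewrite (bigD1 j) //= [in RHS](bigD1 j) //= mulrA -exprS; congr (_ * _).
    rewrite /join degree_setU1 ?pendant_notin // !inE eqxx orbT /=.
    by rewrite prednK // (degree_gt0 tF).
  apply: eq_bigr => v vj; rewrite /join degree_setU1 ?pendant_notin // !inE.
  have [->|vi] := eqVneq v i; last by rewrite (negbTE vj).
  by rewrite (degree_out iF).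
move=> F /andP[tF di]; rewrite (bigD1 i) //= yi0 expr0n.
have := degree_gt0 tF iA A2.
by case: (degree F i) di => [|[|d]] // _ _; rewrite mul0r.
Qed.

Lemma tree_sum_pair G u v y : G u v -> tree_sum G [set u; v] y = 1.
Proof.
move=> Guv; have uv : u != v by apply: contraTneq Guv => ->; rewrite adj_irr.
have A2 : #|[set u; v]| = 2%N by rewrite cards2 uv.
have tree1 : tree_on G [set u; v] [set [set u; v]].
  have t0 : tree_on G [set v] set0.
    apply/and4P; split; first exact: sub0set.
    - by apply/forall_inP=> e; rewrite inE.
    - apply/forall_inP=> a /set1P->; apply/forall_inP=> b /set1P->.
      exact: connect0.
    - apply/acyclicP=> -[|a [|b c]] // _ _ /=.
      by rewrite /edge_rel inE.
  rewrite -[X in tree_on _ _ X]setU0 tree_attach_leaf ?inE ?eqxx //.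
    rewrite orbT Guv /=; congr (tree_on G _ _): t0.
    apply/setP=> a; rewrite !inE andb_orr andNb /=.
    by case: (eqVneq a v) => [->|]; rewrite ?andbF // eq_sym uv.
  by move=> e; rewrite inE.
rewrite /tree_sum (bigD1 [set [set u; v]]) //= [X in _ + X]big1 ?addr0.
  have := tree_sum_pred_degree tree1; rewrite A2 => /(_ isT) /eqP.
  rewrite subnn sum_nat_eq0 => /forallP d0.
  by apply: big1 => w _; rewrite (eqP (d0 w)).
move=> F /andP[tF]; case/negP.
have [w uw] : exists w, edge_rel F u w.
  by apply: (tree_neighbour tF); rewrite ?A2 // !inE eqxx.
rewrite eqEsubset; apply/andP; split.
  apply/subsetP=> e eF.
  have /and4P[sFG _ _ _] := tF.
  have [a [b [Ee _]]] := edgesP sFG eF; rewrite Ee in eF *.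
  have [_] := tree_edge tF eF.
  rewrite !inE set2_eq => ab /orP[]/eqP Ea /orP[]/eqP Eb; move: ab;
    by rewrite Ea Eb !eqxx ?orbT.
rewrite sub1set; have [_ nuw _] := tree_edge tF uw.
by rewrite !inE eq_sym (negbTE nuw) /= => /eqP wv; rewrite -wv.
Qed.

End TreeSum.

Lemma tree_sum_rmorph (V : finType) (R S : comNzRingType) (phi : {rmorphism R -> S})
    (G : sgraph V) A (y : V -> R) :
  phi (tree_sum G A y) = tree_sum G A (phi \o y).
Proof.
rewrite rmorph_sum; apply: eq_bigr => F _; rewrite rmorph_prod.
by apply: eq_bigr => v _; rewrite rmorphXn.
Qed.

(** * Reciprocity *)

Section Specialise.
Variables (N : nat) (R : comNzRingType).
Implicit Types (p : {mpoly R[N]}) (i j : 'I_N).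

Definition zero_var i : {mpoly R[N]} -> {mpoly R[N]} :=
  comp_mpoly [tuple if j == i then 0 else 'X_j | j < N].

HB.instance Definition _ i :=
  GRing.RMorphism.copy (zero_var i)
    (comp_mpoly [tuple if j == i then 0 else 'X_j | j < N]).

Lemma zero_varX i j : zero_var i 'X_j = if j == i then 0 else 'X_j.
Proof. by rewrite /zero_var comp_mpolyXU -tnth_nth tnth_mktuple. Qed.

Lemma mcoeff_zero_var i p (m : 'X_{1..N}) : m i = 0%N -> (zero_var i p)@_m = p@_m.
Proof.
move=> mi0; rewrite {2}(mpolyE p) /zero_var comp_mpolyEX !raddf_sum /=.
apply: eq_bigr => m' _; rewrite !mcoeffZ comp_mpolyX; congr (_ * _).
have [m'i|m'i] := eqVneq (m' i) 0%N.
  rewrite mpolyXE_id; congr (_@_m); apply: eq_bigr => j _; rewrite tnth_mktuple.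
  by case: eqP => // ->; rewrite m'i !expr0.
rewrite (bigD1 i) //= tnth_mktuple eqxx expr0n (negbTE m'i) mul0r mcoeff0 mcoeffX.
by case: eqP => // m'm; rewrite m'm mi0 in m'i.
Qed.

(** A monomial of degree less than |B| misses some variable of [B]; setting that
    variable to 0 keeps its coefficient. *)
Lemma homog_zero_var_eq0 (B : {set 'I_N}) d p :
  p \is d.-homog -> (d < #|B|)%N -> (forall i, i \in B -> zero_var i p = 0) ->
  p = 0.
Proof.
move=> hp dB kp; apply/mpolyP=> m; rewrite mcoeff0.
apply/eqP; apply: contraLR dB => pm; rewrite -leqNgt.
have <- : mdeg m = d.
  by apply: (dhomog_mf hp); rewrite mcoeff_msupp.
rewrite mdegE -sum1_card big_mkcond leq_sum // => i _; case: ifP => // iB.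
rewrite lt0n; apply: contra_neq pm => mi0.
by rewrite -(mcoeff_zero_var p mi0) kp // mcoeff0.
Qed.

(** The values are arbitrary linear forms, so that the lemma applies after the
    substitution for the root variable as well. *)
Lemma tree_sum_homog (G : sgraph 'I_N) (A : {set 'I_N}) (y : 'I_N -> {mpoly R[N]}) :
  (1 < #|A|)%N -> (forall v, y v \is 1.-homog) ->
  tree_sum G A y \is (#|A| - 2).-homog.
Proof.
move=> A2 hy; apply: rpred_sum => F tF.
rewrite -(tree_sum_pred_degree tF A2).
elim/big_ind2: _ => [|d1 p1 d2 p2 h1 h2|v _]; first exact: dhomog1.
  exact: dhomogM.
by have := dhomogMn (degree F v).-1 (hy v); rewrite mul1n.
Qed.

Definition reflect_root r (A : {set 'I_N}) v : {mpoly R[N]} :=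
  if v == r then - 'X_r - \sum_(i in A :\ r) 'X_i else 'X_v.

Lemma reflect_root_homog r A v : reflect_root r A v \is 1.-homog.
Proof.
have hX i : 'X_i \is [in R[N], 1.-homog] by rewrite dhomogX /= mdeg1.
rewrite /reflect_root; case: eqP => // _.
by rewrite rpredB ?rpredN ?rpred_sum.
Qed.

(** Induction on [A], the root being joined to every vertex both in [G] and
    in [H], and [H] being the complement of [G] elsewhere. On two
    vertices there is a single tree, of monomial 1; beyond that the difference of
    the sides is homogeneous of degree |A| - 2 and vanishes at x_i = 0 for each
    of the |A| - 1 other vertices i. *)
Lemma tree_sum_reciprocity (r : 'I_N) (G H : sgraph 'I_N) (A : {set 'I_N}) :
  (forall v, v != r -> G v r && H v r) ->
  (forall u v, u != r -> v != r -> u != v -> H u v = ~~ G u v) ->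
  r \in A -> (1 < #|A|)%N ->
  tree_sum G A (fun v => 'X_v) =
  (-1) ^+ (#|A| - 2) * tree_sum H A (reflect_root r A).
Proof.
move=> adjr compl.
elim: {A}#|A| {-2}A (erefl #|A|) => [|k IHk] A cA rA; first by rewrite cA.
move=> A2; have [k1|k1] := eqVneq k 1%N.
  rewrite cA k1 subnn expr0 mul1r.
  have /cards1P[i Ei] : #|A :\ r| == 1%N.
    by move: cA; rewrite (cardsD1 r) rA k1 => -[/eqP].
  have ir : i != r by have := set11 i; rewrite -Ei !inE => /andP[].
  have /andP[Gir Hir] := adjr i ir.
  by rewrite -(setD1K rA) Ei setUC !tree_sum_pair.
have k2 : (1 < k)%N by rewrite ltn_neqAle eq_sym k1 /=; move: A2; rewrite cA.
apply/eqP; rewrite -subr_eq0; apply/eqP.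
apply: (@homog_zero_var_eq0 (A :\ r) (#|A| - 2)).
- have hX : forall v, 'X_v \is [in R[N], 1.-homog].
    by move=> v; rewrite dhomogX /= mdeg1.
  rewrite rpredB ?tree_sum_homog //.
  rewrite -signr_odd; case: odd; rewrite ?mul1r ?mulN1r ?rpredN tree_sum_homog //;
    by move=> v; apply: reflect_root_homog.
- have : #|A| = #|A :\ r|.+1 by rewrite (cardsD1 r) rA.
  lia.
move=> i; rewrite !inE => /andP[ir iA].
have cAi : #|A :\ i| = k by move: cA; rewrite (cardsD1 i) iA => -[].
have rAi : r \in A :\ i by rewrite !inE eq_sym ir.
have A3 : (2 < #|A|)%N by rewrite cA.
(* Both sides satisfy the leaf recursion at x_i = 0. *)
have zero_sum K (y : 'I_N -> {mpoly R[N]}) : y i = 'X_i ->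
    zero_var i (tree_sum K A y) =
    (\sum_(j in A :\ i | K i j) zero_var i (y j)) *
      tree_sum K (A :\ i) (fun v => zero_var i (y v)).
  move=> yi; rewrite tree_sum_rmorph (tree_sum_leaf _ iA A3) //=.
  by rewrite yi zero_varX eqxx.
(* At x_i = 0 the substitution for A becomes the substitution for A minus i. *)
have zero_root v : v \in A :\ i ->
    zero_var i (reflect_root r A v) = reflect_root r (A :\ i) v.
  rewrite !inE => /andP[vi vA]; rewrite /reflect_root.
  case: eqP => [_|_]; last by rewrite zero_varX (negbTE vi).
  rewrite rmorphB rmorphN rmorph_sum /= zero_varX.
  rewrite eq_sym (negbTE ir); congr (_ - _).
  rewrite (bigD1 i) ?inE ?ir //= zero_varX eqxx add0r.
  apply: eq_big => [j|j /andP[_ ji]]; first by rewrite !inE andbC andbCA.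
  by rewrite zero_varX (negbTE ji).
have zero_id v : v \in A :\ i -> zero_var i 'X_v = 'X_v.
  by rewrite !inE => /andP[vi _]; rewrite zero_varX (negbTE vi).
rewrite rmorphB rmorphM rmorphXn rmorphN1 /= !zero_sum //; last first.
  by rewrite /reflect_root (negbTE ir).
rewrite (eq_tree_sum _ zero_id) (eq_tree_sum _ zero_root).
rewrite (eq_bigr (fun j => 'X_j)) => [|j /andP[/zero_id]] //.
rewrite [X in _ - _ * (X * _)](eq_bigr (reflect_root r (A :\ i)));
  last by move=> j /andP[/zero_root].
rewrite (IHk _ cAi) ?cAi //.
(* This is where the complement and the sign enter: the root is a neighbour
   of i on both sides, and the non-neighbours of i in G, being its neighbours
   in H, cancel against the reflected root variable. *)
have -> : \sum_(j in A :\ i | H i j) reflect_root r (A :\ i) j =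
          - \sum_(j in A :\ i | G i j) 'X_j.
  have /andP[Gir Hir] := adjr i ir.
  rewrite (bigD1 r) ?rAi //= [in RHS](bigD1 r) ?rAi //=.
  rewrite {1}/reflect_root eqxx (bigID (G i)) /= !opprD -!addrA; congr (_ + _).
  rewrite [X in - X + _](eq_bigl
    (fun j => (j \in A :\ i) && G i j && (j != r))); last first.
    by move=> j; rewrite !inE; case: (j != r); rewrite ?andbF ?andbT.
  rewrite -[RHS]addr0; congr (_ + _); apply/eqP; rewrite addrC subr_eq0; apply/eqP.
  apply: eq_big => [j|j /andP[_ /negbTE jr]]; last by rewrite /reflect_root jr.
  rewrite !inE; have [jr|jr] := eqVneq j r; rewrite ?andbF //= !andbT.
  have [//|ji] := eqVneq j i.
  by rewrite compl // eq_sym.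
have -> : (#|A| - 2 = (k - 2).+1)%N by rewrite cA; lia.
by rewrite exprS mulN1r !mulNr mulrN opprK mulrCA subrr.
Qed.

End Specialise.

Lemma graph_poly_tree_sum (n : nat) (G : sgraph 'I_n) :
  graph_poly G = tree_sum (ext_graph G) setT (fun v => 'X_v).
Proof. by apply: eq_bigl => F; rewrite tree_on_setT. Qed.

Theorem theorem5p1 (n : nat) (hn : (1 <= n)%N) (G : sgraph 'I_n) :
  graph_poly G =
  (-1) ^+ (n - 1) *
    subst_x (graph_poly (compl_graph G))
            (- 'X_ord0 - \sum_(i < n) 'X_(lift ord0 i)).
Proof.
have card_V : #|[set: 'I_n.+1]| = n.+1 by rewrite cardsT card_ord.
have V2 : (1 < #|[set: 'I_n.+1]|)%N by rewrite card_V.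
have adj0 v : v != ord0 ->
    ext_graph G v ord0 && ext_graph (compl_graph G) v ord0.
  case: (unliftP ord0 v) => [i ->|->]; rewrite ?eqxx // => _.
  by rewrite /= /ext_adj liftK unlift_none.
have ext_compl (u v : 'I_n.+1) : u != ord0 -> v != ord0 -> u != v ->
    ext_graph (compl_graph G) u v = ~~ ext_graph G u v.
  case: (unliftP ord0 u) => [i ->|->]; rewrite ?eqxx // => _.
  case: (unliftP ord0 v) => [j ->|->]; rewrite ?eqxx // => _.
  by rewrite (inj_eq lift_inj) /= /ext_adj !liftK /= /compl_adj => ->.
rewrite !graph_poly_tree_sum.
rewrite (tree_sum_reciprocity _ adj0 ext_compl (in_setT _) V2) card_V subSS.
congr (_ * _); rewrite /subst_x tree_sum_rmorph; apply: eq_tree_sum => v _.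
rewrite /= comp_mpolyXU -tnth_nth tnth_mktuple /reflect_root.
case: eqP => // _; congr (_ - _).
rewrite (eq_bigl (fun i => i != ord0)) => [|i]; last first.
  by rewrite in_setD1 in_setT andbT.
by rewrite big_mkcond big_ord_recl eqxx /= add0r.
Qed.
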